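(* Any finite set $A\subset\mathbf{N}$ of $n=|A|\geqslant 1$ positive integers satisfies $$\min_{x\in[0,2\pi]}\sum_{a\in A}\cos(ax)\leqslant -n^{1/5-o(1)}.$$ Explicitly: there is a function $\eta:\mathbf{N}\to\mathbf{R}$ with $\eta(n)\to 0$ as $n\to\infty$ such that for every $n\geqslant 1$ and every set $A$ of $n$ positive integers, $\min_{x\in[0,2\pi]}\sum_{a\in A}\cos(ax)\leqslant -n^{1/5-\eta(n)}$.
   Context: $\mathbf{N}$ denotes the positive integers. The term $o(1)$ denotes a quantity tending to $0$ as $n\to\infty$, depending only on $n$ (uniform over all sets $A$ of size $n$). *)

(* Defs.v *)
From HB Require Import structures.
From mathcomp Require Import all_boot all_order all_algebra finmap.
From mathcomp Require Import all_classical all_reals all_analysis.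
Set Implicit Arguments.
Unset Strict Implicit.
Unset Printing Implicit Defensive.
Import Order.TTheory GRing.Theory Num.Theory numFieldNormedType.Exports.
Local Open Scope classical_set_scope.
Local Open Scope ring_scope.

(* Relational, hence it also asserts that the minimum is attained; it is
   unique by antisymmetry. *)
Definition is_minimum (R : realType) (S : set R) (m : R) : Prop :=
  S m /\ lbound S m.

Definition cosine_sum (R : realType) (A : {fset nat}) (x : R) : R :=
  \sum_(a <- A) cos (a%:R * x).

(* Main.v *)
Require Import Defs.
From HB Require Import structures.
From mathcomp Require Import all_boot all_order all_algebra finmap.
From mathcomp Require Import all_classical all_reals all_analysis.
From mathcomp Require Import ring lra zify.
Import Order.TTheory GRing.Theory Num.Theory numFieldNormedType.Exports.
Local Open Scope classical_set_scope.
Local Open Scope ring_scope.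

(** Let n be the size of A, f the cosine sum of A, - K its minimum, and put
    M = 2 K + 1, N = 2 n and F = M + 2 f. Then F >= 1, F is even, F has mean M
    and maximum F(0) = M + N, and its Fourier coefficients are M at the
    frequency 0 and 0 or 1 elsewhere. With averages for integrals, the last
    fact says that the convolution square of F is F + (M^2 - M). The proof
    derives N = O(M^5 + M^4 ln (M + N)) from these properties and from the
    connectedness of the circle.

    The circle is replaced by the cyclic group of order q, for a huge q: the
    orthogonality relations stay exact as soon as q > 2 max A, and
    connectedness survives as the fact that F varies little between
    neighbouring points.

    - F - (M - 1) is an idempotent for convolution, hence a projection. So the
      quadratic form of the kernel F(x - y) is at most the square norm, up to
      M - 1 times the square of the mean ([form_le]).

    - Weight the closed walks 0, x, z, y by the product
      F(x) F(z - x) F(y) F(z - y) of their sides, and let xi be the product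
      (F(z) + M^2 - M) F(x - y) of the diagonals divided by the square root
      of this weight. Evaluated at s_z(x) = sqrt (F(x) F(z - x)), the bound on
      quadratic forms says that the mean of xi is at most 1 + e, where
      e = O((M^5 + M^4 ln (M + N)) / N). The convolution identity says that
      sides and diagonals have almost the same distribution, so the mean of
      ln xi is at least - e. If e is small, the two together force xi to be
      close to 1: for some z, the normalization g of s_z
      satisfies F(x - y) >= g(x) g(y) up to a small error in square mean
      ([exists_minorant]).

    - Translate g by t. The overlap rho of g and its translate g_t is 1 at
      t = 0 and small on average, so by connectedness it lies between 1/4
      and 3/4 for some t. As F is translation invariant, it dominates both
      g(x) g(y) and g_t(x) g_t(y), hence their maximum, and this makes the
      quadratic form of F at g + g_t exceed the square norm of g + g_t by
      rho (1 - rho), up to small errors ([overlap]). This contradicts the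
      first point unless N is small ([value_at_zero_le]).

    It follows that K >= n^(1/5) / 80, and the constant 80 is absorbed in
    eta(n) = ln 80 / ln n. *)

(** * Averages over a finite type *)

Definition av {R : realType} {T : finType} (f : T -> R) : R :=
  (\sum_x f x) / #|T|%:R.

Section Average.
Context {R : realType} {T : finType}.
Implicit Types f g : T -> R.

Lemma eq_av f g : f =1 g -> av f = av g.
Proof. by move=> fg; rewrite /av (eq_bigr g). Qed.

Lemma avD f g : av (fun x => f x + g x) = av f + av g.
Proof. by rewrite /av big_split mulrDl. Qed.

Lemma avZ c f : av (fun x => c * f x) = c * av f.
Proof. by rewrite /av -mulr_sumr mulrA. Qed.

Lemma avZr c f : av (fun x => f x * c) = av f * c.
Proof. by rewrite mulrC -avZ; apply: eq_av => x; rewrite mulrC. Qed.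

Lemma avB f g : av (fun x => f x - g x) = av f - av g.
Proof. by rewrite /av sumrB mulrBl. Qed.

Lemma av_sum (I : Type) (r : seq I) (F : I -> T -> R) :
  av (fun x => \sum_(i <- r) F i x) = \sum_(i <- r) av (F i).
Proof. by rewrite /av exchange_big mulr_suml. Qed.

Lemma ler_av f g : (forall x, f x <= g x) -> av f <= av g.
Proof.
by move=> fg; rewrite /av ler_wpM2r ?invr_ge0 ?ler0n// ler_sum.
Qed.

Lemma av_ge0 f : (forall x, 0 <= f x) -> 0 <= av f.
Proof. by move=> f0; rewrite /av divr_ge0 ?ler0n// sumr_ge0. Qed.

Lemma av_reindex (h : T -> T) f : injective h -> av (f \o h) = av f.
Proof. by move=> hI; rewrite /av [in RHS](reindex_inj hI). Qed.

Lemma av_quad (u v : T -> R) (al be ga : R) :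
  av (fun y => al * u y ^+ 2 + be * (u y * v y) + ga * v y ^+ 2) =
  al * av (fun y => u y ^+ 2) + be * av (fun y => u y * v y)
  + ga * av (fun y => v y ^+ 2).
Proof. by rewrite !avD !avZ. Qed.

Context (T_gt0 : (0 < #|T|)%N).

Lemma av_cst (c : R) : av (fun _ : T => c) = c.
Proof.
rewrite /av sumr_const -[c *+ _]mulr_natr mulfK//.
by rewrite pnatr_eq0 -lt0n.
Qed.

Lemma exists_le_av f c : av f <= c -> exists x, f x <= c.
Proof.
move=> fc; apply: contrapT => /forallNP H.
suff : c < av f by rewrite ltNge fc.
rewrite -{1}(av_cst c) /av ltr_pM2r ?invr_gt0 ?ltr0n//.
apply: ltr_sum => [|x _]; last by rewrite ltNge; apply/negP/H.
by have /card_gt0P[x _] := T_gt0; apply/hasP; exists x; rewrite ?mem_index_enum.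
Qed.

Lemma exists_le_weighted_av (w f : T -> R) c : (forall x, 0 < w x) ->
  av (fun x => w x * f x) <= c * av w -> exists x, f x <= c.
Proof.
move=> w0; rewrite -avZ -subr_le0 -avB => /exists_le_av[x].
by rewrite [c * _]mulrC -mulrBr pmulr_rle0// subr_le0; exists x.
Qed.

End Average.

Lemma exchange_av {R : realType} {S T : finType} (f : S -> T -> R) :
  av (fun x => av (fun y => f x y)) = av (fun y => av (fun x => f x y)).
Proof.
rewrite /av -!mulr_suml exchange_big/= -!mulrA; congr (_ * _).
exact: mulrC.
Qed.

Section GroupAverage.
Context {R : realType} {G : finZmodType}.
Implicit Types f : G -> R.

Lemma av_translate t f : av (fun x => f (x - t)) = av f.
Proof. exact: (@av_reindex _ _ (fun x => x - t) f (addIr _)). Qed.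

Lemma av_reflect t f : av (fun x => f (t - x)) = av f.
Proof.
by apply: (@av_reindex _ _ (fun x => t - x) f) => x y /addrI/oppr_inj.
Qed.

Lemma card_zmod_gt0 : (0 < #|G|)%N.
Proof. by apply/card_gt0P; exists 0. Qed.

End GroupAverage.

(** * The quadratic form of a translation-invariant kernel *)

Definition form {R : realType} {G : finZmodType} (k f : G -> R) : R :=
  av (fun x => av (fun y => f x * f y * k (x - y))).

(** Convolution by E is a self-adjoint projection p, and
    |f|^2 - <f, p f> = |f - p f|^2 >= 0. *)
Lemma form_idempotent_le (R : realType) (G : finZmodType) (E f : G -> R) :
  (forall x, E (- x) = E x) ->
  (forall x, av (fun y => E y * E (x - y)) = E x) ->
  form E f <= av (fun x => f x ^+ 2).
Proof.
move=> Eev Eid; pose p x := av (fun y => E (x - y) * f y).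
have fp : av (fun x => f x * p x) = form E f.
  apply: eq_av => x; rewrite -avZ; apply: eq_av => y; ring.
have pp : av (fun x => p x ^+ 2) = form E f.
  transitivity (av (fun x => av (fun y => av (fun y' =>
      f y * f y' * (E (x - y) * E (x - y')))))).
    apply: eq_av => x; rewrite expr2 {1}/p -avZr; apply: eq_av => y.
    by rewrite -avZ; apply: eq_av => y'; ring.
  rewrite exchange_av; apply: eq_av => y.
  rewrite exchange_av; apply: eq_av => y'; rewrite avZ; congr (_ * _).
  rewrite -(opprB y') Eev -(Eid (y' - y)).
  rewrite -[RHS](av_translate y); apply: eq_av => x; congr (_ * _).
  by rewrite -Eev; congr E; rewrite !opprB addrA subrK.
have : 0 <= av (fun x => (f x - p x) ^+ 2) by apply: av_ge0 => x; exact: sqr_ge0.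
have -> : av (fun x => (f x - p x) ^+ 2) = av (fun x => 1 * f x ^+ 2
    + (- 2) * (f x * p x) + 1 * p x ^+ 2).
  by apply: eq_av => x; ring.
rewrite av_quad fp pp; lra.
Qed.

(** * Two translates of a minorant cannot half overlap *)

(** With K = a b and K' = a' b', the three terms on the right add up to at
    least max(K, K') times (a + a') (b + b') = K + K' + (a b' + a' b), and
    max(K, K') = (K + K') / 2 + |K - K'| / 2. The left-hand side comes from
    |K - K'| (K + K') >= (K - K')^2 and |K - K'| >= s (K - K'); it is a
    quadratic form in (b, b'), so it can be averaged exactly. *)
Lemma overlap_pointwise (R : realType) (a b a' b' k s : R) :
  0 <= a -> 0 <= b -> 0 <= a' -> 0 <= b' -> `|s| <= 1 ->
  (a * b + a' * b') / 2 * ((a + a') * (b + b'))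
    + (a * b - a' * b') ^+ 2 / 2
    + s * (a * b - a' * b') * (a * b' + a' * b) / 2
  <= k * ((a + a') * (b + b'))
     + Num.max 0 (a * b - k) * ((a + a') * (b + b'))
     + Num.max 0 (a' * b' - k) * ((a + a') * (b + b')).
Proof.
move=> a0 b0 a'0 b'0 s1.
have ff0 : 0 <= (a + a') * (b + b') by rewrite mulr_ge0// addr_ge0.
set K := a * b; set K' := a' * b'; set ff := (a + a') * (b + b').
have K0 : 0 <= K by rewrite mulr_ge0.
have K'0 : 0 <= K' by rewrite mulr_ge0.
have ffE : ff = K + K' + (a * b' + a' * b) by rewrite /ff /K /K'; ring.
set c := a * b' + a' * b in ffE *.
have c0 : 0 <= c by rewrite addr_ge0// mulr_ge0.
have kmax : Num.max K K' <= k + Num.max 0 (K - k) + Num.max 0 (K' - k).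
  have h1 : 0 <= Num.max 0 (K - k) by rewrite le_max lexx.
  have h2 : K - k <= Num.max 0 (K - k) by rewrite le_max lexx orbT.
  have h3 : 0 <= Num.max 0 (K' - k) by rewrite le_max lexx.
  have h4 : K' - k <= Num.max 0 (K' - k) by rewrite le_max lexx orbT.
  by rewrite ge_max; apply/andP; split; lra.
have := ler_wpM2r ff0 kmax.
have -> : Num.max K K' = (K + K') / 2 + `|K - K'| / 2.
  by rewrite maxr_absE; field.
move=> kmaxff.
have hs : s * (K - K') <= `|K - K'|.
  apply: le_trans (ler_norm _) _; rewrite normrM.
  by rewrite -[leRHS]mul1r ler_wpM2r.
have hK : (K - K') ^+ 2 <= `|K - K'| * (K + K').
  rewrite -(real_normK (num_real _)) expr2 ler_wpM2l// ler_norml.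
  by apply/andP; split; lra.
have := ler_wpM2r c0 hs; move: kmaxff; rewrite -/ff ffE; clearbody K K' c; lra.
Qed.

(** Evaluate the form at f = g + h, where h is the translate of g by t. If
    F(x - y) >= g(x) g(y) held exactly, then it would hold for h as well, and
    [overlap_pointwise] would bound the form from below by
    |f|^2 + rho (1 - rho), where |f|^2 = 2 + 2 rho: the terms free of s average
    to |f|^2 exactly, and the gain rho (1 - rho) comes from the term in s with
    s = sign (g - h), as |g^2 - h^2| >= (g - h)^2. The parameter la balances
    the cost of the positive parts of g(x) g(y) - F(x - y). *)
Lemma overlap (R : realType) (G : finZmodType) (F g : G -> R) (m la rho : R) (t : G) :
  (forall f : G -> R,
     form F f <= av (fun x => f x ^+ 2) + m * av f ^+ 2) ->
  (forall x, 0 <= g x) -> av (fun x => g x ^+ 2) = 1 -> 0 < la ->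
  av (fun x => g x * g (x - t)) = rho ->
  rho * (1 - rho) <=
    av (fun x => av (fun y => Num.max 0 (g x * g y - F (x - y)) ^+ 2)) / la
    + 16 * la + 4 * m * av g ^+ 2.
Proof.
move=> formF g0 g1 la0 rhoE.
set D := av (fun x => av _).
pose h x := g (x - t).
have h0 x : 0 <= h x by exact: g0.
have h1 : av (fun x => h x ^+ 2) = 1 by rewrite -g1 -(av_translate t).
have gh : av (fun x => g x * h x) = rho by exact: rhoE.
pose e x y := Num.max 0 (g x * g y - F (x - y)).
pose e' x y := Num.max 0 (h x * h y - F (x - y)).
have De : av (fun x => av (fun y => e x y ^+ 2)) = D by [].
have De' : av (fun x => av (fun y => e' x y ^+ 2)) = D.
  rewrite -De -[RHS](av_translate t); apply: eq_av => x.
  rewrite -[RHS](av_translate t); apply: eq_av => y.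
  by rewrite /e' /e /h opprB addrA subrK.
pose f x := g x + h x.
have rho1 : rho <= 1.
  have : 0 <= av (fun x => (g x - h x) ^+ 2) by apply: av_ge0 => x; exact: sqr_ge0.
  have -> : av (fun x => (g x - h x) ^+ 2) = av (fun x => 1 * g x ^+ 2
      + (- 2) * (g x * h x) + 1 * h x ^+ 2).
    by apply: eq_av => x; ring.
  by rewrite av_quad g1 h1 gh; lra.
have rho0 : 0 <= rho by rewrite -gh; apply: av_ge0 => x; rewrite mulr_ge0.
have f2 : av (fun x => f x ^+ 2) = 2 + 2 * rho.
  have -> : av (fun x => f x ^+ 2) = av (fun x => 1 * g x ^+ 2
      + 2 * (g x * h x) + 1 * h x ^+ 2).
    by apply: eq_av => x; rewrite /f; ring.
  by rewrite av_quad g1 h1 gh; lra.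
have fav : av f = 2 * av g.
  by rewrite /f avD /h (av_translate t) mulr_natl mulr2n.
have f4 : av (fun x => av (fun y => (f x * f y) ^+ 2)) <= 16.
  have -> : av (fun x => av (fun y => (f x * f y) ^+ 2)) = (2 + 2 * rho) ^+ 2.
    rewrite -{1}f2 expr2 -avZr; apply: eq_av => x.
    by rewrite -avZ; apply: eq_av => y; rewrite exprMn.
  by have : 0 <= (1 - rho) * (3 + rho) by [apply: mulr_ge0; lra]; lra.
(* Young's inequality, for the error terms of g and of h *)
have Yg (d : G -> G -> R) :
    av (fun x => av (fun y => d x y * (f x * f y)))
    <= av (fun x => av (fun y => d x y ^+ 2)) / (2 * la) + 8 * la.
  have -> : av (fun x => av (fun y => d x y ^+ 2)) / (2 * la) =
      av (fun x => av (fun y => (2 * la)^-1 * d x y ^+ 2)).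
    by rewrite mulrC -avZ; apply: eq_av => x; rewrite avZ.
  have : av (fun x => av (fun y => la / 2 * (f x * f y) ^+ 2)) <= 8 * la.
    have -> : av (fun x => av (fun y => la / 2 * (f x * f y) ^+ 2)) =
        la / 2 * av (fun x => av (fun y => (f x * f y) ^+ 2)).
      by rewrite -avZ; apply: eq_av => x; rewrite avZ.
    apply: le_trans (_ : la / 2 * 16 <= _); last by lra.
    by rewrite ler_wpM2l//; lra.
  move=> h8; apply: le_trans (lerD (lexx _) h8); rewrite -avD.
  apply: ler_av => x; rewrite -avD; apply: ler_av => y.
  rewrite -subr_ge0.
  have -> : (2 * la)^-1 * d x y ^+ 2 + la / 2 * (f x * f y) ^+ 2
      - d x y * (f x * f y) = (2 * la)^-1 * (d x y - la * (f x * f y)) ^+ 2.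
    by field; rewrite gt_eqF.
  by rewrite mulr_ge0 ?sqr_ge0// invr_ge0; lra.
have upper : av (fun x => av (fun y => F (x - y) * (f x * f y)
     + e x y * (f x * f y) + e' x y * (f x * f y))) <=
   2 + 2 * rho + m * (2 * av g) ^+ 2 + D / la + 16 * la.
  have -> : av (fun x => av (fun y => F (x - y) * (f x * f y)
     + e x y * (f x * f y) + e' x y * (f x * f y))) = form F f +
    av (fun x => av (fun y => e x y * (f x * f y))) +
    av (fun x => av (fun y => e' x y * (f x * f y))).
    rewrite -!avD; apply: eq_av => x; rewrite -!avD; apply: eq_av => y; ring.
  have := Yg e; have := Yg e'; have := formF f; rewrite De De' f2 fav.
  have -> : D / (2 * la) = D / la / 2 by field; rewrite gt_eqF.
  lra.
pose s x := Num.sg (g x - h x).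
have s1 x : `|s x| <= 1 by rewrite normr_sg; case: (_ != 0).
have lower x : (1 + rho) / 2 * (g x + h x) ^+ 2 + (g x ^+ 2 + h x ^+ 2) / 2
      - rho * (g x * h x) + rho / 2 * (g x - h x) ^+ 2 <=
    av (fun y => F (x - y) * (f x * f y)
     + e x y * (f x * f y) + e' x y * (f x * f y)).
  have := ler_av _ _ (fun y => overlap_pointwise _ _ _ _ _ (F (x - y))
    (s x) (g0 x) (g0 y) (h0 x) (h0 y) (s1 x)).
  move=> Hp; apply: le_trans Hp.
  have -> : av (fun y => (g x * g y + h x * h y) / 2 * ((g x + h x) * (g y + h y)) +
    (g x * g y - h x * h y) ^+ 2 / 2 +
    s x * (g x * g y - h x * h y) * (g x * h y + h x * g y) / 2) =
   av (fun y => ((g x + h x) * g x / 2 + g x ^+ 2 / 2 + s x * g x * h x / 2) * g y ^+ 2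
     + ((g x + h x) ^+ 2 / 2 - g x * h x + s x * (g x ^+ 2 - h x ^+ 2) / 2)
         * (g y * h y)
     + ((g x + h x) * h x / 2 + h x ^+ 2 / 2 - s x * g x * h x / 2) * h y ^+ 2).
    by apply: eq_av => y; field.
  rewrite av_quad g1 h1 gh.
  have key : (g x - h x) ^+ 2 <= s x * (g x ^+ 2 - h x ^+ 2).
    have -> : s x * (g x ^+ 2 - h x ^+ 2) = `|g x - h x| * (g x + h x).
      by rewrite normrEsg /s; ring.
    rewrite -(real_normK (num_real _)) expr2 ler_wpM2l// ler_norml.
    by have := g0 x; have := h0 x => ? ?; apply/andP; split; lra.
  have := ler_wpM2l rho0 key; lra.
have := le_trans (ler_av _ _ lower) upper.
have -> : av (fun x => (1 + rho) / 2 * (g x + h x) ^+ 2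
      + (g x ^+ 2 + h x ^+ 2) / 2
      - rho * (g x * h x) + rho / 2 * (g x - h x) ^+ 2) =
  av (fun x => ((1 + rho) / 2 + 1 / 2 + rho / 2) * g x ^+ 2
   + ((1 + rho) - rho - rho) * (g x * h x)
   + ((1 + rho) / 2 + 1 / 2 + rho / 2) * h x ^+ 2).
  by apply: eq_av => x; field.
rewrite av_quad g1 h1 gh; lra.
Qed.

(** * Closed walks of length four *)

(** Quantitative Jensen inequality: with xi = w / r, the right-hand side is
    4 r^2 (xi - 1 - ln xi), and xi - 1 - ln xi >= (1 - sqrt xi)^2 because
    ln (sqrt xi) <= sqrt xi - 1. *)
Lemma sqr_max_le_log (R : realType) (r w : R) : 0 < r -> 0 < w ->
  Num.max 0 (r - w) ^+ 2 <= 4 * (w * r - r ^+ 2 - r ^+ 2 * (ln w - ln r)).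
Proof.
move=> r0 w0; pose t := Num.sqrt (w / r).
have t0 : 0 < t by rewrite sqrtr_gt0 divr_gt0.
have wE : w = r * t ^+ 2.
  by rewrite sqr_sqrtr ?divr_ge0 ?ltW// mulrC divfK// gt_eqF.
have lnE : ln w - ln r = 2 * ln t.
  by rewrite wE lnM ?posrE ?exprn_gt0// lnXn// addrC addKr mulr_natl.
have lnt : ln t <= t - 1.
  by have := @le_ln1Dx R (t - 1); rewrite addrCA subrr addr0; apply; lra.
rewrite lnE; apply: le_trans (_ : 4 * (r ^+ 2 * (1 - t) ^+ 2) <= _); last first.
  by have := ler_wpM2l (sqr_ge0 r) lnt; rewrite wE; lra.
have [wr|rw] := leP (r - w) 0.
  by rewrite expr0n/= mulr_ge0// mulr_ge0 ?sqr_ge0.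
have t1 : t < 1.
  rewrite ltNge; apply/negP => t1; move: rw; apply/negP; rewrite -leNgt subr_le0.
  by rewrite wE ler_peMr ?(ltW r0)// exprn_ege1.
have -> : (r - w) ^+ 2 = r ^+ 2 * (1 - t) ^+ 2 * (1 + t) ^+ 2 by rewrite wE; ring.
rewrite mulrC; apply: ler_wpM2r; first by apply: mulr_ge0; exact: sqr_ge0.
by have : 0 <= (1 - t) * (3 + t) by [apply: mulr_ge0; lra]; lra.
Qed.

Section FourCycles.
Context {R : realType} {G : finZmodType} (F : G -> R) (M L : R).
Context (F_even : forall x, F (- x) = F x).
Context (F_ge1 : forall x, 1 <= F x).
Context (F_av : av F = M).
Context (F_conv : forall x, av (fun y => F y * F (x - y)) = F x + (M ^+ 2 - M)).
Context (F_log : forall x, ln (F x) <= L).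

Let c : R := M ^+ 2 - M.
(* the convolution square of F *)
Let ct z := F z + c.
Let s z x := Num.sqrt (F x * F (z - x)).

Let F0 x : 0 <= F x. Proof. exact: le_trans ler01 (F_ge1 x). Qed.
Let Fgt0 x : 0 < F x. Proof. exact: lt_le_trans ltr01 (F_ge1 x). Qed.

Lemma M_ge1 : 1 <= M.
Proof. by rewrite -F_av -(av_cst (@card_zmod_gt0 G) 1); apply: ler_av. Qed.

Let c_ge0 : 0 <= c.
Proof. by have := M_ge1 => M1; rewrite /c subr_ge0 expr2 ler_peMl//; lra. Qed.

Let ct_ge x : F x <= ct x. Proof. by rewrite lerDl. Qed.
Let ct_ge1 x : 1 <= ct x. Proof. exact: le_trans (F_ge1 x) (ct_ge x). Qed.
Let ct_gt0 x : 0 < ct x. Proof. exact: lt_le_trans ltr01 (ct_ge1 x). Qed.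

Lemma form_le (f : G -> R) :
  form F f <= av (fun x => f x ^+ 2) + (M - 1) * av f ^+ 2.
Proof.
pose E x := F x - (M - 1).
have -> : form F f = form E f + (M - 1) * av f ^+ 2.
  rewrite expr2 mulrCA -avZr -avD; apply: eq_av => x.
  rewrite mulrCA -!avZ -avD; apply: eq_av => y; rewrite /E; ring.
rewrite lerD2r; apply: form_idempotent_le => x; first by rewrite /E F_even.
have -> : av (fun y => E y * E (x - y)) = av (fun y => F y * F (x - y)
   - (M - 1) * F y - (M - 1) * F (x - y) + (M - 1) ^+ 2).
  by apply: eq_av => y; rewrite /E; ring.
rewrite avD !avB !avZ F_conv av_reflect F_av av_cst ?card_zmod_gt0// /E; ring.
Qed.

Let convct x : av (fun y => F y * F (x - y)) = ct x.
Proof. exact: F_conv. Qed.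

Let av_ct : av ct = M ^+ 2.
Proof. by rewrite avD F_av av_cst ?card_zmod_gt0// /c; ring. Qed.

Let s_sq z x : s z x ^+ 2 = F x * F (z - x).
Proof. by rewrite sqr_sqrtr// mulr_ge0. Qed.

Let s_ge0 z x : 0 <= s z x. Proof. exact: sqrtr_ge0. Qed.

Let s_gt0 z x : 0 < s z x. Proof. by rewrite sqrtr_gt0 mulr_gt0. Qed.

Let av_s2 z : av (fun x => s z x ^+ 2) = ct z.
Proof. by rewrite -convct; apply: eq_av => x; rewrite s_sq. Qed.

Let av_s_le z : av (s z) <= M.
Proof.
have -> : M = av (fun x => (F x + F (z - x)) / 2).
  by rewrite avZr avD av_reflect F_av; field.
apply: ler_av => x; have h : 0 <= (F x + F (z - x)) / 2.
  by rewrite divr_ge0// addr_ge0.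
rewrite -(@ler_pXn2r _ 2)// ?nnegrE// s_sq -subr_ge0.
have -> : ((F x + F (z - x)) / 2) ^+ 2 - F x * F (z - x) =
  ((F x - F (z - x)) / 2) ^+ 2 by field.
exact: sqr_ge0.
Qed.

(* The weight of the closed walk 0, x, z, y. The next lemmas give the law of
   each of its sides x, z - x, y, z - y and of its diagonals z, x - y. *)
Let wt z x y := F x * F (z - x) * (F y * F (z - y)).

Let av3 (f : G -> G -> G -> R) :=
  av (fun z => av (fun x => av (fun y => f z x y))).

Let av3_swap f : av3 f = av3 (fun z x y => f z y x).
Proof. by apply: eq_av => z; exact: exchange_av. Qed.

Let wt_z phi : av3 (fun z x y => wt z x y * phi z) = av (fun z => ct z ^+ 2 * phi z).
Proof.
apply: eq_av => z.
transitivity (av (fun x => F x * F (z - x) * (ct z * phi z))).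
  by apply: eq_av => x; rewrite -convct -avZr -avZ; apply: eq_av => y; rewrite /wt; ring.
by rewrite avZr convct; ring.
Qed.

Let wt_x phi : av3 (fun z x y => wt z x y * phi x) =
  av (fun x => F x * (F x + c + c * M) * phi x).
Proof.
rewrite /av3 exchange_av; apply: eq_av => x.
transitivity (av (fun z => F x * phi x * (F z * F (x - z) + c * F (x - z)))).
  apply: eq_av => z.
  transitivity (av (fun y => F x * phi x * F (x - z) * (F y * F (z - y)))).
    by apply: eq_av => y; rewrite /wt -(F_even (z - x)) opprB; ring.
  by rewrite avZ convct /ct; ring.
by rewrite avZ avD avZ convct av_reflect F_av /ct; ring.
Qed.

Let wt_zx phi : av3 (fun z x y => wt z x y * phi (z - x)) =
  av (fun x => F x * (F x + c + c * M) * phi x).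
Proof.
rewrite -wt_x; apply: eq_av => z; rewrite -[RHS](av_reflect z).
by apply: eq_av => x; apply: eq_av => y; rewrite /wt subKr; ring.
Qed.

Let wt_y phi : av3 (fun z x y => wt z x y * phi y) =
  av (fun x => F x * (F x + c + c * M) * phi x).
Proof.
rewrite av3_swap -wt_x; apply: eq_av => z; apply: eq_av => x; apply: eq_av => y.
by rewrite /wt; ring.
Qed.

Let wt_zy phi : av3 (fun z x y => wt z x y * phi (z - y)) =
  av (fun x => F x * (F x + c + c * M) * phi x).
Proof.
rewrite av3_swap -wt_zx; apply: eq_av => z; apply: eq_av => x; apply: eq_av => y.
by rewrite /wt; ring.
Qed.

Let wt_xy phi : av3 (fun z x y => wt z x y * phi (x - y)) =
  av (fun z => ct z ^+ 2 * phi z).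
Proof.
rewrite /av3 exchange_av.
transitivity (av (fun x => av (fun y => F x * F y * ct (x - y) * phi (x - y)))).
  apply: eq_av => x; rewrite exchange_av; apply: eq_av => y.
  transitivity (av (fun z => F x * F y * phi (x - y) * (F (x - z) * F (z - y)))).
    by apply: eq_av => z; rewrite /wt -(F_even (z - x)) opprB; ring.
  rewrite avZ; have -> : av (fun z => F (x - z) * F (z - y)) = ct (x - y).
    rewrite -convct -[RHS](av_reflect x); apply: eq_av => z; congr (_ * F _).
    by rewrite opprB [RHS]addrC addrA subrK.
  ring.
transitivity (av (fun x => av (fun y => F x * F (x - y) * ct y * phi y))).
  apply: eq_av => x; rewrite -[RHS](av_reflect x); apply: eq_av => y.
  by rewrite subKr.
rewrite exchange_av; apply: eq_av => y.
transitivity (av (fun x => ct y * phi y * (F x * F (y - x)))).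
  by apply: eq_av => x; rewrite -(F_even (y - x)) opprB; ring.
by rewrite avZ convct; ring.
Qed.

Let Z := av (fun z => ct z ^+ 2).

Let lF x := ln (F x).
Let lF_ge0 x : 0 <= lF x. Proof. exact: ln_ge0. Qed.

(* Up to the factor Z, the mean of ln xi with F(z) and F(x - y) as diagonals:
   the laws (F + c)^2 of the diagonals and F (F + c + c M) of the sides differ
   by c (F + c) - c M F, whose negative part is c M F. *)
Let entropy_ge :
  - (2 * M ^+ 4 * L) <= av3 (fun z x y => wt z x y *
     (lF z + lF (x - y)
      - (lF x + lF (z - x) + lF y + lF (z - y)) / 2)).
Proof.
have -> : av3 (fun z x y => wt z x y *
     (lF z + lF (x - y)
      - (lF x + lF (z - x) + lF y + lF (z - y)) / 2)) =
  av3 (fun z x y => wt z x y * lF z) + av3 (fun z x y => wt z x y * lF (x - y))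
  - (av3 (fun z x y => wt z x y * lF x) + av3 (fun z x y => wt z x y * lF (z - x))
   + av3 (fun z x y => wt z x y * lF y) + av3 (fun z x y => wt z x y * lF (z - y))) / 2.
  rewrite /av3 -!avD -avZr -avB; apply: eq_av => z.
  rewrite -!avD -avZr -avB; apply: eq_av => x.
  by rewrite -!avD -avZr -avB; apply: eq_av => y; field.
rewrite wt_z wt_x wt_zx wt_y wt_zy wt_xy.
have -> : av (fun z => ct z ^+ 2 * lF z) + av (fun z => ct z ^+ 2 * lF z) -
    (av (fun x => F x * (F x + c + c * M) * lF x) +
     av (fun x => F x * (F x + c + c * M) * lF x) +
     av (fun x => F x * (F x + c + c * M) * lF x) +
     av (fun x => F x * (F x + c + c * M) * lF x)) / 2 =
    2 * (av (fun z => ct z ^+ 2 * lF z)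
         - av (fun x => F x * (F x + c + c * M) * lF x)) by field.
rewrite -avB.
have : - (c * M * L * M) <= av (fun x => ct x ^+ 2 * lF x
     - F x * (F x + c + c * M) * lF x).
  rewrite -{2}F_av -mulNr -avZ; apply: ler_av => x.
  have -> : ct x ^+ 2 * lF x - F x * (F x + c + c * M) * lF x =
    c * (F x + c) * lF x - c * M * (lF x * F x) by rewrite /ct; ring.
  have h1 : 0 <= c * (F x + c) * lF x by rewrite mulr_ge0// mulr_ge0// addr_ge0.
  have h2 : lF x * F x <= L * F x by rewrite ler_wpM2r ?F_log.
  have h3 : 0 <= c * M by rewrite mulr_ge0//; have := M_ge1; lra.
  have := ler_wpM2l h3 h2; lra.
have L0 : 0 <= L by exact: le_trans (lF_ge0 0) (F_log 0).
have : 0 <= M ^+ 3 * L.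
  by rewrite mulr_ge0// exprn_ge0//; have := M_ge1; lra.
rewrite /c; lra.
Qed.

Let g z x := s z x / Num.sqrt (ct z).

Let sqrt_ct z : Num.sqrt (ct z) ^+ 2 = ct z.
Proof. by rewrite sqr_sqrtr// ltW. Qed.

(** For each z take g proportional to s_z(x) = sqrt (F(x) F(z - x)), with unit
    norm. Then r = s_z(x) s_z(y) is the square root of the weight of the walk
    0, x, z, y, and the deficit of F(x - y) with respect to g(x) g(y) is
    governed by xi = ct(z) F(x - y) / r. By [sqr_max_le_log], the deficit is
    small on average over z, with weight ct(z)^2, once the mean of xi - 1 is
    small, which is [form_le] at s_z, and the mean of ln xi is not too
    negative. The explicit shape of g serves to bound its variation. *)
Lemma exists_minorant : exists2 g : G -> R,
  [/\ (forall x, 0 <= g x), av (fun x => g x ^+ 2) = 1 &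
      exists z a, [/\ 0 < a <= 1 & forall x, g x = Num.sqrt (F x * F (z - x)) * a]] &
  av (fun x => av (fun y => Num.max 0 (g x * g y - F (x - y)) ^+ 2))
    + M * av g ^+ 2 <= (5 * M ^+ 5 + 8 * M ^+ 4 * L) / F 0.
Proof.
have M1 := M_ge1.
have ZF : F 0 <= Z.
  apply: le_trans (_ : ct 0 <= _); first exact: ct_ge.
  rewrite -convct; apply: ler_av => x; rewrite sub0r F_even -expr2.
  by rewrite lerXn2r ?nnegrE// ltW.
have Z0 : 0 < Z by exact: lt_le_trans (Fgt0 0) ZF.
have L0 : 0 <= L by exact: le_trans (lF_ge0 0) (F_log 0).
pose D z := av (fun x => av (fun y => Num.max 0 (g z x * g z y - F (x - y)) ^+ 2)).
have DE z : ct z ^+ 2 * D z =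
    av (fun x => av (fun y => Num.max 0 (s z x * s z y - ct z * F (x - y)) ^+ 2)).
  rewrite /D -avZ; apply: eq_av => x; rewrite -avZ; apply: eq_av => y.
  rewrite -exprMn maxr_pMr ?ltW// mulr0; congr (Num.max 0 _ ^+ 2).
  rewrite mulrBr; congr (_ - _); rewrite /g mulrACA -invfM -expr2 sqrt_ct.
  by rewrite mulrC divfK// gt_eqF.
(* the mean of xi - 1 - ln xi *)
have cycle : av (fun z => ct z ^+ 2 * D z) <=
    4 * (M ^+ 4 * (M - 1) + 2 * M ^+ 4 * L).
  apply: le_trans (_ : 4 * (
    av3 (fun z x y => ct z * (s z x * s z y * F (x - y))) - av3 (fun z x y => wt z x y * 1)
    - av3 (fun z x y => wt z x y * (lF z + lF (x - y)
      - (lF x + lF (z - x) + lF y + lF (z - y)) / 2))) <= _).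
    rewrite /av3 -!avB -avZ; apply: ler_av => z; rewrite DE.
    rewrite -!avB -avZ; apply: ler_av => x; rewrite -!avB -avZ; apply: ler_av => y.
    have r0 : 0 < s z x * s z y by rewrite mulr_gt0.
    have w0 : 0 < ct z * F (x - y) by rewrite mulr_gt0.
    apply: le_trans (sqr_max_le_log _ _ _ r0 w0) _; rewrite ler_pM2l//.
    have wtE : (s z x * s z y) ^+ 2 = wt z x y by rewrite exprMn !s_sq.
    have lnr : ln (s z x * s z y) = (lF x + lF (z - x) + lF y + lF (z - y)) / 2.
      have : ln ((s z x * s z y) ^+ 2) = ln (wt z x y) by rewrite wtE.
      rewrite lnXn// /wt !lnM ?posrE ?mulr_gt0// /lF mulr2n; lra.
    have lnw : lF z + lF (x - y) <= ln (ct z * F (x - y)).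
      by rewrite lnM ?posrE// lerD2r /lF ler_ln ?posrE.
    have wt0 : 0 <= wt z x y by rewrite -wtE sqr_ge0.
    rewrite wtE lnr; have := ler_wpM2l wt0 lnw; lra.
  rewrite ler_pM2l// (wt_z (fun=> 1)).
  have := entropy_ge.
  have -> : av (fun z => ct z ^+ 2 * 1) = Z by apply: eq_av => z; rewrite mulr1.
  have : av3 (fun z x y => ct z * (s z x * s z y * F (x - y))) <= Z + M ^+ 4 * (M - 1).
    have -> : M ^+ 4 * (M - 1) = av (fun z => ct z * (M ^+ 2 * (M - 1))).
      by rewrite avZr av_ct; ring.
    rewrite -avD; apply: ler_av => z.
    have -> : av (fun x => av (fun y => ct z * (s z x * s z y * F (x - y)))) =
        ct z * form F (s z).
      by rewrite -avZ; apply: eq_av => x; rewrite -avZ.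
    rewrite expr2 -mulrDr ler_pM2l//.
    apply: le_trans (form_le _) _; rewrite av_s2 lerD2l mulrC ler_wpM2r ?subr_ge0//.
    rewrite lerXn2r ?nnegrE// ?av_s_le//; first by apply: av_ge0.
    lra.
  lra.
have mass : av (fun z => ct z ^+ 2 * (M * av (g z) ^+ 2)) <= M ^+ 5.
  have -> : M ^+ 5 = av (fun z => ct z * M ^+ 3) by rewrite avZr av_ct; ring.
  apply: ler_av => z; rewrite expr2 -mulrA ler_pM2l//.
  have -> : ct z * (M * av (g z) ^+ 2) = M * av (s z) ^+ 2.
    by rewrite /g avZr exprMn exprVn sqrt_ct; field; rewrite gt_eqF.
  rewrite [M ^+ 3]exprS ler_pM2l ?lerXn2r ?nnegrE ?av_s_le//; try lra.
  exact: av_ge0.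
have [z zP] : exists z, D z + M * av (g z) ^+ 2 <= (5 * M ^+ 5 + 8 * M ^+ 4 * L) / Z.
  apply: (@exists_le_weighted_av _ _ (@card_zmod_gt0 G) (fun z => ct z ^+ 2)).
    by move=> z; rewrite exprn_gt0.
  rewrite divfK ?gt_eqF//.
  have -> : av (fun z => ct z ^+ 2 * (D z + M * av (g z) ^+ 2)) =
    av (fun z => ct z ^+ 2 * D z) + av (fun z => ct z ^+ 2 * (M * av (g z) ^+ 2)).
    by rewrite -avD; apply: eq_av => z; rewrite mulrDr.
  have : 0 <= M ^+ 4 by rewrite exprn_ge0//; lra.
  lra.
exists (g z).
  split=> [x||]; first by rewrite divr_ge0// sqrtr_ge0.
    have -> : av (fun x => g z x ^+ 2) = av (fun x => s z x ^+ 2 * (ct z)^-1).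
      by apply: eq_av => x; rewrite exprMn exprVn sqrt_ct.
    by rewrite avZr av_s2 divff// gt_eqF.
  exists z, (Num.sqrt (ct z))^-1; split=> //.
  have h1 : 1 <= Num.sqrt (ct z) by rewrite -[leLHS]sqrtr1 ler_sqrt// ltW.
  by rewrite invr_gt0 (lt_le_trans ltr01 h1)/= invf_le1// (lt_le_trans ltr01 h1).
apply: le_trans zP _; rewrite ler_wpM2l ?lef_pV2 ?posrE//.
have hM n : 0 <= M ^+ n by rewrite exprn_ge0//; lra.
by have := hM 5; have := mulr_ge0 (hM 4) L0; lra.
Qed.

End FourCycles.

(** * Intermediate overlaps and the bound on F(0) *)

Lemma sqrt_le_add (R : realType) (p p' e : R) : 0 <= p -> 1 <= p' -> 0 <= e ->
  p <= p' + 2 * e -> Num.sqrt p <= Num.sqrt p' + e.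
Proof.
move=> p0 p'1 e0 pp'.
have h1 : 1 <= Num.sqrt p' by rewrite -[leLHS]sqrtr1 ler_sqrt//; lra.
rewrite -(@ler_pXn2r _ 2)// ?nnegrE ?sqrtr_ge0//; last by lra.
rewrite sqr_sqrtr//; apply: le_trans pp' _.
rewrite -{1}(@sqr_sqrtr _ p'); last by lra.
have : 0 <= (Num.sqrt p' - 1) * e by rewrite mulr_ge0//; lra.
have : 0 <= e ^+ 2 by exact: sqr_ge0.
lra.
Qed.

Section Connectedness.
Context {R : realType} {G : finZmodType} (u : G).
Context (u_gen : forall x : G, exists k, x = u *+ k).

(** The window from 1/4 to 3/4 has length 1/2, so a path with steps at most 1/2
    cannot jump over it on its way down from 1. *)
Lemma discrete_ivt (rho : G -> R) : rho 0 = 1 ->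
  (forall t, rho t - rho (t + u) <= 1 / 2) -> (exists t, rho t <= 1 / 4) ->
  exists t, 1 / 4 <= rho t <= 3 / 4.
Proof.
move=> rho0 rhoS [t]; have [k ->] := u_gen t => rk.
have ex : exists k, rho (u *+ k) <= 3 / 4 by exists k; lra.
case: (ex_minnP ex) => -[|j] rj jmin.
  by move: rj; rewrite mulr0n rho0; lra.
exists (u *+ j.+1); rewrite rj andbT.
have : 3 / 4 < rho (u *+ j) by rewrite ltNge; apply/negP => /jmin; rewrite ltnn.
by have := rhoS (u *+ j); rewrite -mulrSr; lra.
Qed.

Context (F : G -> R) (M L B de : R).
Context (F_even : forall x, F (- x) = F x).
Context (F_ge1 : forall x, 1 <= F x).
Context (F_av : av F = M).
Context (F_conv : forall x, av (fun y => F y * F (x - y)) = F x + (M ^+ 2 - M)).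
Context (F_log : forall x, ln (F x) <= L).
Context (F_le : forall x, F x <= B).
Context (F_lip : forall x, `|F x - F (x - u)| <= de).
Context (deB : de * B <= 1 / 2).

(** If F(0) were larger, then [exists_minorant] would provide g with total
    error less than 1/2000. The overlap of g with its translates has mean
    (av g)^2, which is tiny, and drops by at most 1/2 at each step u. At an
    overlap rho between 1/4 and 3/4, [overlap] with la = 1/200 bounds
    rho (1 - rho) >= 3/16 by 16/200 + 200/2000, which is absurd. *)
Lemma value_at_zero_le : F 0 <= 2000 * (5 * M ^+ 5 + 8 * M ^+ 4 * L).
Proof.
rewrite leNgt; apply/negP => F0big.
have F00 : 0 < F 0 by exact: lt_le_trans ltr01 (F_ge1 0).
have M1 : 1 <= M by exact: M_ge1 F_ge1 F_av.
have [g [g0 g1 [z [a [/andP[a0 a1] gE]]]] gD] :=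
  exists_minorant F M L F_even F_ge1 F_av F_conv F_log.
set D := av _ in gD.
have {F0big gD} th : D + M * av g ^+ 2 < 1 / 2000.
  by apply: le_lt_trans gD _; rewrite ltr_pdivrMr//; lra.
have D0 : 0 <= D by apply: av_ge0 => x; apply: av_ge0 => y; exact: sqr_ge0.
have g2 : av g ^+ 2 <= M * av g ^+ 2 by rewrite ler_peMl// sqr_ge0.
have avg0 : 0 <= av g by exact: av_ge0.
have avg1 : av g <= 1.
  have -> : 1 = av (fun x => (g x ^+ 2 + 1) / 2).
    by rewrite avZr avD g1 av_cst ?card_zmod_gt0//; field.
  by apply: ler_av => x; have := sqr_ge0 (g x - 1); lra.
pose rho t := av (fun x => g x * g (x - t)).
have [t /andP[t1 t2]] : exists t, 1 / 4 <= rho t <= 3 / 4.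
  apply: discrete_ivt.
  - by rewrite -g1; apply: eq_av => x; rewrite subr0.
  - have glip y : g y - g (y - u) <= 1 / 2.
      have B0 : 0 <= B by exact: le_trans (ltW F00) (F_le 0).
      have de0 : 0 <= de by exact: le_trans (normr_ge0 _) (F_lip 0).
      have : Num.sqrt (F y * F (z - y)) <=
             Num.sqrt (F (y - u) * F (z - (y - u))) + de * B.
        apply: sqrt_le_add; rewrite ?mulr_ge0//.
        - by rewrite ltW// (lt_le_trans ltr01).
        - by rewrite ltW// (lt_le_trans ltr01).
        - by rewrite -[1]mulr1 ler_pM.
        have h1 := le_trans (ler_norm _) (F_lip y).
        have := F_lip (z - (y - u)); rewrite ler_norml => /andP[+ _].
        have -> : z - (y - u) - u = z - y by rewrite opprB addrA addrAC addrK.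
        move=> h2; rewrite -subr_ge0.
        have -> : F (y - u) * F (z - (y - u)) + 2 * (de * B) - F y * F (z - y) =
          de * (B - F (z - y)) + de * (B - F (y - u))
          + (de - (F y - F (y - u))) * F (z - y)
          + F (y - u) * (de - (F (z - y) - F (z - (y - u)))) by ring.
        have F0 x : 0 <= F x by exact: le_trans ler01 (F_ge1 x).
        by rewrite !addr_ge0// mulr_ge0// subr_ge0//; lra.
      rewrite !gE -mulrBl => hs; have := ler_wpM2l (ltW a0) hs.
      have h3 : a * (de * B) <= 1 / 2.
        by apply: le_trans deB; rewrite ler_piMl// mulr_ge0.
      rewrite mulrDr mulrBl; lra.
    move=> t; rewrite /rho -avB.
    apply: le_trans (_ : av (fun x => g x * (1 / 2)) <= _); last first.
      by rewrite avZr; lra.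
    apply: ler_av => x; rewrite -mulrBr ler_wpM2l//.
    by rewrite opprD addrA.
  apply: (exists_le_av (@card_zmod_gt0 G)).
  have -> : av rho = av g ^+ 2.
    rewrite /rho exchange_av expr2 -avZr; apply: eq_av => x.
    by rewrite avZ av_reflect.
  lra.
have la0 : 0 < 200^-1 :> R by lra.
have formF f := form_le F M F_even F_av F_conv f.
have := overlap R G F g (M - 1) 200^-1 (rho t) t formF g0 g1 la0 erefl.
rewrite -/D invrK.
have : 0 <= (rho t - 1 / 4) * (3 / 4 - rho t) by rewrite mulr_ge0// subr_ge0.
have : 0 <= av g ^+ 2 by exact: sqr_ge0.
lra.
Qed.

End Connectedness.


(** * Cosine sums sampled at the multiples of 2 pi / q *)

Section CyclicSamples.
Context {R : realType} (q' : nat).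
Local Notation q := q'.+1.

Definition angle (n : nat) : R := 2 * pi * n%:R / q'.+1%:R.

Lemma cosD2pin (x : R) n : cos (x + 2 * pi * n%:R) = cos x.
Proof.
have -> : 2 * pi * n%:R = pi *+ 2 *+ n :> R.
  by rewrite mulr_natr [2 * pi]mulr_natl.
exact: (periodicn (@cosD2pi R)).
Qed.

Lemma cos_angle_mod a n phi :
  cos (a%:R * angle (n %% q) + phi) = cos (a%:R * angle n + phi).
Proof.
rewrite -[RHS](_ : cos (a%:R * angle (n %% q) + phi + 2 * pi * (a * (n %/ q))%:R) = _).
  by rewrite cosD2pin.
congr cos; rewrite [in RHS](divn_eq n q) /angle natrM natrD natrM.
by field.
Qed.

Lemma cos_angleB a (x y : 'I_q) phi :
  cos (a%:R * angle (x - y)%R + phi) = cos (a%:R * angle x - a%:R * angle y + phi).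
Proof.
rewrite /= cos_angle_mod.
have -> : a%:R * angle (x + (q'.+1 - y) %% q'.+1) + phi =
  a%:R * angle ((q'.+1 - y) %% q'.+1) + (a%:R * angle x + phi).
  by rewrite /angle natrD; field.
rewrite cos_angle_mod -[RHS](cosD2pin _ a); congr cos.
by rewrite /angle natrB ?(ltnW (ltn_ord y))//; field.
Qed.

(** Multiplied by 2 sin (pi k / q), the sum telescopes. *)
Lemma av_cos_angle k phi : (0 < k < q)%N ->
  av (fun x : 'I_q => cos (k%:R * angle x + phi)) = 0.
Proof.
move=> /andP[k0 kq]; rewrite /av.
have -> : \sum_(x < q) cos (k%:R * angle x + phi) = 0; last by rewrite mul0r.
pose h : R := pi * k%:R / q%:R.
have h0 : 0 < sin h.
  apply: sin_gt0_pi; rewrite /h divr_gt0 ?mulr_gt0 ?pi_gt0 ?ltr0n//=.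
  by rewrite ltr_pdivrMr ?ltr0n// ltr_pM2l ?pi_gt0// ltr_nat.
have angleE n : k%:R * angle n = 2 * h * n%:R by rewrite /angle /h; field.
apply: (mulfI (lt0r_neq0 (mulr_gt0 (ltr0Sn R 1) h0))); rewrite mulr0.
pose S n := sin (2 * h * n%:R - h + phi).
have tel : 2 * sin h * \sum_(x < q) cos (k%:R * angle x + phi) = S q - S 0%N.
  rewrite mulr_sumr -(big_mkord xpredT (fun x => 2 * sin h * cos (k%:R * angle x + phi))).
  rewrite -telescope_sumr//; apply: eq_big_nat => n _; rewrite angleE /S.
  set X := 2 * h * n%:R + phi.
  have -> : 2 * h * n.+1%:R - h + phi = X + h by rewrite /X -natr1; ring.
  have -> : 2 * h * n%:R - h + phi = X - h by rewrite /X; ring.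
  by rewrite sinD sinB; ring.
rewrite tel /S mulr0 sub0r.
have -> : 2 * h * q%:R - h + phi = - h + phi + pi *+ 2 *+ k.
  by rewrite -mulr_natr -[pi *+ 2]mulr_natl /h; field.
by rewrite (periodicn (@sinD2pi R)) subrr.
Qed.

Lemma av_cosM_angle a b (x : 'I_q) :
  (0 < a)%N -> (0 < b)%N -> (2 * a < q)%N -> (2 * b < q)%N ->
  av (fun y : 'I_q => cos (a%:R * angle y) * cos (b%:R * angle (x - y)%R)) =
  (a == b)%:R / 2 * cos (b%:R * angle x).
Proof.
move=> a0 b0 aq bq.
have ltq n : (2 * n < q)%N -> (n < q)%N by apply: leq_ltn_trans; rewrite leq_pmull.
have -> : av (fun y : 'I_q => cos (a%:R * angle y) * cos (b%:R * angle (x - y)%R)) =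
  (av (fun y : 'I_q => cos ((a + b)%:R * angle y - b%:R * angle x)) +
   av (fun y : 'I_q => cos (a%:R * angle y - b%:R * angle y + b%:R * angle x))) / 2.
  rewrite -avD -avZr; apply: eq_av => y.
  have := cos_angleB b x y 0; rewrite !addr0 => ->.
  set X := b%:R * angle x; set Y := a%:R * angle y; set W := b%:R * angle y.
  have -> : (a + b)%:R * angle y - X = Y - (X - W) by rewrite natrD /X /Y /W; ring.
  have -> : Y - W + X = Y + (X - W) by ring.
  by rewrite (cosB Y) (cosD Y); field.
rewrite av_cos_angle ?add0r; last first.
  rewrite addn_gt0 a0/= -(@ltn_pmul2l 2)// mulnDr [X in (_ < X)%N]mul2n -addnn.
  exact: leq_trans (leq_add aq (ltnW bq)).
case: (ltngtP a b) => ab /=.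
- rewrite !mul0r; apply/eqP; rewrite mulf_eq0; apply/orP; left; apply/eqP.
  rewrite -[RHS](av_cos_angle (b - a) (- (b%:R * angle x))); last first.
    by rewrite subn_gt0 ab (leq_ltn_trans (leq_subr _ _))// ltq.
  have E : (b - a)%:R = b%:R - a%:R :> R by rewrite natrB// ltnW.
  by rewrite E; apply: eq_av => y; rewrite -[LHS]cosN; congr (cos _); ring.
- rewrite !mul0r; apply/eqP; rewrite mulf_eq0; apply/orP; left; apply/eqP.
  rewrite -[RHS](av_cos_angle (a - b) (b%:R * angle x)); last first.
    by rewrite subn_gt0 ab (leq_ltn_trans (leq_subr _ _))// ltq.
  have E : (a - b)%:R = a%:R - b%:R :> R by rewrite natrB// ltnW.
  by rewrite E; apply: eq_av => y; congr (cos _); ring.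
- have -> : av (fun y : 'I_q => cos (a%:R * angle y - b%:R * angle y + b%:R * angle x))
    = av (fun _ : 'I_q => cos (b%:R * angle x)).
    by apply: eq_av => y; rewrite ab subrr add0r.
  by rewrite av_cst ?card_ord// mulrC mul1r.
Qed.

End CyclicSamples.

Lemma cos_lip (R : realType) (x h : R) : 0 <= h -> `|cos x - cos (x - h)| <= h.
Proof.
move=> h0; have xh : x - h <= x by rewrite gerBl.
have [|c _ ->] := @MVT_segment R cos (fun y => - sin y) (x - h) x xh.
  by apply: continuous_subspaceT => y; exact: continuous_cos.
by rewrite opprB addrC subrK normrM normrN (ger0_norm h0) ler_piMl ?sin_max.
Qed.

(** Average (F - 1) (F(0) - F) >= 0. For F = M + 2 f with M = 2 K + 1, the
    conclusion means K >= 1/2, so that K is at least M / 4. *)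
Lemma mean_ge2 (R : realType) (G : finZmodType) (F : G -> R) (M : R) :
  (forall x, F (- x) = F x) -> (forall x, 1 <= F x <= F 0) ->
  av F = M -> (forall x, av (fun y => F y * F (x - y)) = F x + (M ^+ 2 - M)) ->
  M < F 0 -> 2 <= M.
Proof.
move=> Fev Fb Fav Fconv MF0.
have : 0 <= av (fun x => (F x - 1) * (F 0 - F x)).
  by apply: av_ge0 => x; have /andP[? ?] := Fb x; rewrite mulr_ge0// subr_ge0.
have -> : av (fun x => (F x - 1) * (F 0 - F x)) =
    av (fun x => (F 0 + 1) * F x - F x * F (0 - x) - F 0).
  by apply: eq_av => x; rewrite sub0r Fev; ring.
rewrite !avB avZ Fav Fconv av_cst ?card_zmod_gt0//.
have -> : (F 0 + 1) * M - (F 0 + (M ^+ 2 - M)) - F 0 = (M - 2) * (F 0 - M) by ring.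
by rewrite pmulr_lge0 ?subr_ge0// subr_gt0.
Qed.

Section SampledCosineSum.
Context {R : realType} (A : {fset nat}) (q' : nat).
Local Notation q := q'.+1.
Context (A_gt0 : forall a : nat, a \in A -> (0 < a)%N).
Context (A_ltq : forall a : nat, a \in A -> (2 * a < q)%N).

Let S (x : 'I_q) : R := cosine_sum A (angle q' x).

Lemma cosine_sum0 : cosine_sum A 0 = (#|` A|%fset)%:R :> R.
Proof.
rewrite /cosine_sum (eq_bigr (fun _ => 1)); last by move=> a _; rewrite mulr0 cos0.
by rewrite big_const_seq count_predT iter_addr_0 cardfE.
Qed.

Let angle0 : angle q' 0 = 0 :> R.
Proof. by rewrite /angle mulr0 mul0r. Qed.

Lemma sampled_even x : S (- x) = S x.
Proof.
apply: eq_bigr => a _; have := @cos_angleB R q' a 0 x 0.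
by rewrite !addr0 sub0r angle0 mulr0 sub0r cosN.
Qed.

Lemma av_sampled : av S = 0.
Proof.
rewrite /S /cosine_sum av_sum big_seq big1// => a aA.
rewrite -[RHS](@av_cos_angle R q' a 0).
  by apply: eq_av => x; rewrite addr0.
by rewrite A_gt0//=; have := A_ltq a aA; lia.
Qed.

Lemma sampled_conv x : av (fun y => S y * S (x - y)) = S x / 2.
Proof.
transitivity (av (fun y : 'I_q => \sum_(a <- A) \sum_(b <- A)
    (cos (a%:R * angle q' y) * cos (b%:R * angle q' (x - y)%R)) : R)).
  by apply: eq_av => y; rewrite mulr_suml; apply: eq_bigr => a _; rewrite mulr_sumr.
rewrite av_sum; under eq_bigr do rewrite av_sum.
rewrite /S /cosine_sum mulr_suml big_seq [RHS]big_seq; apply: eq_bigr => a aA.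
rewrite (bigD1_seq a)//= ?fset_uniq//.
rewrite av_cosM_angle ?A_gt0 ?A_ltq// eqxx big_seq_cond big1 ?addr0 => [|b /andP[bA ba]].
  by rewrite mul1r mulrC.
by rewrite av_cosM_angle ?A_gt0 ?A_ltq// eq_sym (negbTE ba) !mul0r.
Qed.

Lemma sampled_lip x : (1 < q)%N ->
  `|S x - S (x - inZp 1)| <= (\sum_(a <- A) a)%:R * angle q' 1.
Proof.
move=> q1; rewrite /S /cosine_sum -sumrB natr_sum mulr_suml.
apply: le_trans (ler_norm_sum _ _ _) _; apply: ler_sum => a _.
have := @cos_angleB R q' a x (inZp 1) 0; rewrite !addr0 => ->.
rewrite /= modn_small//; apply: cos_lip.
by rewrite mulr_ge0// /angle !mulr_ge0 ?pi_ge0// invr_ge0.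
Qed.

End SampledCosineSum.

Lemma inZp_gen q' (x : 'I_q'.+1) : exists k, x = inZp 1 *+ k.
Proof.
exists x; rewrite -[LHS]valZpK; elim: (x : nat) => [|n IH].
  by apply: val_inj; rewrite /= mod0n.
by rewrite mulrSr -IH; apply: val_inj; rewrite /= modnDm addn1.
Qed.

Lemma cosine_sum_le (R : realType) (A : {fset nat}) (x : R) :
  cosine_sum A x <= (#|` A|%fset)%:R.
Proof.
by rewrite -cosine_sum0; apply: ler_sum => a _; rewrite mulr0 cos0 cos_le1.
Qed.

(** * The lower bound on the minimum *)

(** The order q of the cyclic group exceeds 2 max A, so that the frequencies in
    A and their opposites stay distinct and nonzero modulo q, and also X, so
    that consecutive samples are close enough for [value_at_zero_le]. *)
Lemma cosine_sum_bound (R : realType) (A : {fset nat}) (M : R) :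
  let N : R := 2 * (#|` A|%fset)%:R in
  (0 < #|` A|%fset)%N -> (forall a : nat, a \in A -> (0 < a)%N) ->
  (forall x, x \in `[0, 2 * pi] -> 1 <= M + 2 * cosine_sum A x) ->
  2 <= M /\ M + N <= 2000 * (5 * M ^+ 5 + 8 * M ^+ 4 * ln (M + N)).
Proof.
move=> N A0 Apos Mlow.
have N0 : 0 < N by rewrite mulr_gt0// ltr0n.
have MN1 : 1 <= M + N.
  rewrite /N -(@cosine_sum0 R); apply: Mlow.
  by rewrite in_itv/= lexx mulr_ge0 ?pi_ge0.
pose s := (\sum_(a <- A) a)%N.
pose X : R := 16 * pi * s%:R * (M + N).
have X0 : 0 <= X by rewrite !mulr_ge0 ?pi_ge0//; lra.
pose q' := (Num.bound X + 2 * s).+1.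
have qX : X < q'.+1%:R.
  by apply: lt_le_trans (archi_boundP X0) _; rewrite ler_nat /q'; lia.
have As a : a \in A -> (a <= s)%N.
  by move=> aA; rewrite /s (bigD1_seq a)//= leq_addr.
have Aq a : a \in A -> (2 * a < q'.+1)%N by move=> /As; rewrite /q'; lia.
pose F (x : 'I_q'.+1) : R := M + 2 * cosine_sum A (angle q' x).
have F0 : F 0 = M + N.
  by rewrite /F /angle mulr0 mul0r cosine_sum0.
have Fev x : F (- x) = F x by rewrite /F (sampled_even A q').
have Fge1 x : 1 <= F x.
  apply: Mlow; rewrite in_itv/= /angle !mulr_ge0 ?pi_ge0 ?invr_ge0//=.
  rewrite ler_pdivrMr ?ltr0n// ler_pM2l ?mulr_gt0 ?pi_gt0//.
  by rewrite ler_nat ltnW// ltn_ord.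
have FleB x : F x <= M + N.
  by rewrite /F /N lerD2l ler_pM2l// cosine_sum_le.
have card0 : (0 < #|'I_q'.+1|)%N by rewrite card_ord.
have Fav : av F = M.
  by rewrite avD avZ av_cst// (av_sampled A q')// mulr0 addr0.
have Fconv x : av (fun y => F y * F (x - y)) = F x + (M ^+ 2 - M).
  have -> : av (fun y => F y * F (x - y)) =
    av (fun y : 'I_q'.+1 => M ^+ 2 + 2 * M * cosine_sum A (angle q' y)
      + 2 * M * cosine_sum A (angle q' (x - y)%R)
      + 4 * (cosine_sum A (angle q' y) * cosine_sum A (angle q' (x - y)%R))).
    by apply: eq_av => y; rewrite /F; ring.
  rewrite !avD !avZ av_cst// (sampled_conv A q')// (av_sampled A q')//.
  rewrite (av_reflect x (fun y : 'I_q'.+1 => cosine_sum A (angle q' y))).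
  by rewrite (av_sampled A q')// /F; field.
split.
  apply: (mean_ge2 R _ F M) => //; last by rewrite F0 ltrDl.
  by move=> x; rewrite Fge1 F0 FleB.
rewrite -F0.
apply: (value_at_zero_le (inZp 1) (inZp_gen q') F M (ln (F 0)) (M + N)
  (2 * (s%:R * angle q' 1))) => //.
- by move=> x; rewrite ler_ln ?posrE ?F0//; apply: lt_le_trans ltr01 _.
- move=> x; rewrite /F opprD addrACA subrr add0r -mulrBr normrM ger0_norm// ler_pM2l//.
  exact: (sampled_lip A q').
- rewrite /angle mulr1.
  have -> : 2 * (s%:R * (2 * pi / q'.+1%:R)) * (M + N) = X / q'.+1%:R / 4 by rewrite /X; field.
  have : X / q'.+1%:R <= 1 by rewrite ler_pdivrMr ?ltr0n// mul1r ltW.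
  by move: (X / _) => Y; lra.
Qed.

(** With y = n^(1/5), the bound reads y^5 = O(M^5 + M^4 y), because
    ln (M + 2 n) = O(y); so M is at least a constant multiple of y. *)
Lemma mean_ge_root (R : realType) (n : nat) (M : R) : (0 < n)%N -> 0 <= M ->
  M + 2 * n%:R <= 2000 * (5 * M ^+ 5 + 8 * M ^+ 4 * ln (M + 2 * n%:R)) ->
  n%:R `^ 5^-1 / 20 <= M.
Proof.
move=> n0 M0 bound; set y := _ `^ _.
have n1 : 1 <= n%:R :> R by rewrite ler1n.
have y5 : n%:R = y ^+ 5 :> R.
  by rewrite -powR_mulrn ?powR_ge0// -powRrM mulVf// powRr1// ler0n.
have y1 : 1 <= y.
  have <- : 1 `^ 5^-1 = 1 :> R by rewrite powR1.
  by rewrite ge0_ler_powR ?nnegrE ?invr_ge0 ?ler0n.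
rewrite leNgt; apply/negP => My.
have y4 : 0 <= y ^+ 4 by rewrite exprn_ge0//; lra.
have y5' : 1 <= y ^+ 5 by rewrite exprn_ege1.
have yy5 : y <= y ^+ 5 by rewrite -[leLHS]expr1 ler_weXn2l.
have lny : ln y <= y - 1.
  by have := @le_ln1Dx R (y - 1); rewrite addrCA subrr addr0; apply; lra.
have ln3 : ln 3 <= 2 :> R.
  by have := @le_ln1Dx R 2; rewrite (_ : 1 + 2 = 3 :> R); [apply; lra | ring].
have lnB : ln (M + 2 * n%:R) <= 5 * y.
  apply: le_trans (_ : ln (3 * y ^+ 5) <= _).
    by rewrite ler_ln ?posrE ?y5; lra.
  by rewrite lnM ?posrE// ?lnXn// ?mulr2n; [lra | lra | lra..].
have ln0 : 0 <= ln (M + 2 * n%:R) by apply: ln_ge0; lra.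
have M5 : M ^+ 5 <= (y / 20) ^+ 5 by rewrite lerXn2r ?nnegrE//; lra.
have M4 : M ^+ 4 <= (y / 20) ^+ 4 by rewrite lerXn2r ?nnegrE//; lra.
have M4l : M ^+ 4 * ln (M + 2 * n%:R) <= (y / 20) ^+ 4 * (5 * y).
  by rewrite ler_pM// exprn_ge0.
move: bound M5 M4l; rewrite y5 -(mulrA 8).
move: (M ^+ 5) (M ^+ 4 * ln _) => P Q; lra.
Qed.

Lemma cosine_sum_continuous (R : realType) (A : {fset nat}) :
  continuous (@cosine_sum R A).
Proof.
rewrite /cosine_sum; apply: (continuous_big _ (op := +%R)).
  exact: add_continuous.
move=> a _ x; apply: (@continuous_comp _ _ _ (fun x : R => a%:R * x) cos).
  exact: mulrl_continuous.
exact: continuous_cos.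
Qed.

Theorem theorem1p1 (R : realType) :
  exists eta : nat -> R,
    (eta n @[n --> \oo] --> (0 : R)) /\
    forall (n : nat) (A : {fset nat}),
      (1 <= n)%N ->
      #|` A|%fset = n ->
      (forall a : nat, a \in A -> (0 < a)%N) ->
      exists m : R,
        is_minimum [set cosine_sum A x | x in `[0, 2 * pi]] m /\
        m <= - (n%:R `^ (5^-1 - eta n)).
Proof.
exists (fun n => ln 80 / ln n%:R); split.
  rewrite -[X in _ --> X](mulr0 (ln 80)).
  apply: cvgM; first exact: cvg_cst.
  have lnoo : ln (n%:R : R) @[n --> \oo] --> +oo.
    apply/cvgryPge => B.
    have /cvgryPge/(_ (expR B)) := @cvgr_idn R.
    apply: filterS => n Bn.
    by rewrite -(expRK B) ler_ln ?posrE ?expR_gt0// (lt_le_trans (expR_gt0 B)).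
  apply/gtr0_cvgV0 => //.
  by move/cvgryPgt : lnoo; exact.
move=> n A n1 cardA Apos.
have pi0 : 0 <= 2 * pi :> R by rewrite mulr_ge0 ?pi_ge0.
have [x0 x0I xmin] := EVT_min pi0 (continuous_subspaceT (cosine_sum_continuous R A)).
exists (cosine_sum A x0); split.
  split; first by exists x0.
  by move=> _ [x xI <-]; apply: xmin.
pose M := 1 - 2 * cosine_sum A x0.
have [M2 bound] : 2 <= M /\ M + 2 * n%:R <=
    2000 * (5 * M ^+ 5 + 8 * M ^+ 4 * ln (M + 2 * n%:R)).
  rewrite -cardA; apply: cosine_sum_bound; rewrite ?cardA//.
  by move=> x /xmin; rewrite /M; lra.
have root := mean_ge_root _ _ _ n1 (le_trans (ler0n _ 2) M2) bound.
have [n_le1|n_gt1] := leqP n 1.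
  have {n_le1 n1} n1 : n = 1%N by apply/eqP; rewrite eqn_leq n_le1.
  (* here the constant 80 cannot be absorbed: the bound is - 1, which is the
     value at pi / a *)
  rewrite n1 powR1; move/eqP: cardA; rewrite n1 => /cardfs1P[a Aa].
  have a0 : (0 < a)%N by apply: Apos; rewrite Aa inE.
  have : cosine_sum A x0 <= cosine_sum A (pi / a%:R).
    apply: xmin; rewrite in_itv/= divr_ge0 ?pi_ge0//= ler_pdivrMr ?ltr0n//.
    have : 1 <= a%:R :> R by rewrite ler1n.
    by move/(ler_wpM2l pi0); have := pi_ge0 R; lra.
  by rewrite {2}Aa /cosine_sum big_seq_fset1 mulrC divfK ?cospi// pnatr_eq0 -lt0n.
have n0 : (0 : R) < n%:R by rewrite ltr0n ltnW.
have lnn : ln n%:R != 0 :> R by rewrite gt_eqF// ln_gt0// ltr1n.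
have -> : n%:R `^ (5^-1 - ln 80 / ln n%:R) = n%:R `^ 5^-1 / 80 :> R.
  rewrite powRB ?(gt_eqF n0) ?implybT//; congr (_ / _).
  by rewrite /powR (gt_eqF n0) divfK// lnK// posrE.
move: root M2; rewrite /M; lra.
Qed.
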